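(* Let $\mathbf{k}$ be a field of characteristic $0$ and let $(A,\mu,\alpha)$ be a multiplicative right Hom-alternative algebra over $\mathbf{k}$ in which $\alpha$ is injective. Then for all $a,b \in A$, \[ (a,a,b)^4 = 0, \] where $(\cdot,\cdot,\cdot)$ is the Hom-associator of $A$ and $(\cdot)^4$ denotes the fourth Hom-power.
   Context: A Hom-algebra over $\mathbf{k}$ is a triple $(A,\mu,\alpha)$ where $A$ is a $\mathbf{k}$-module, $\mu\colon A^{\otimes 2}\to A$ is a bilinear map (written $xy=\mu(x,y)$; not assumed associative, commutative or unital), and $\alpha\colon A\to A$ is a linear map (the twisting map). It is multiplicative if $\alpha(xy)=\alpha(x)\alpha(y)$ for all $x,y\in A$. The Hom-associator is $(x,y,z)=(xy)\alpha(z)-\alpha(x)(yz)$. $A$ is right Hom-alternative if $(x,y,y)=0$ for all $x,y\in A$. $\alpha^n$ is the $n$-fold composition of $\alpha$, with $\alpha^0=\mathrm{Id}$. The Hom-powers of $x\in A$ are defined by $x^1=x$ and $x^n=x^{n-1}\alpha^{n-2}(x)$ for $n\ge 2$; thus $x^4=((xx)\alpha(x))\alpha^2(x)$. *)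

(* Defs.v *)
From HB Require Import structures.
From mathcomp Require Import all_boot all_order all_algebra.

Set Implicit Arguments.
Unset Strict Implicit.
Unset Printing Implicit Defensive.

Import GRing.Theory.
Local Open Scope ring_scope.

(* A bilinear map on A x A stands for the linear map on the tensor square. *)
Record homAlgebra (k : comNzRingType) := HomAlgebra {
  carrier :> lmodType k;
  mu : {bilinear carrier -> carrier -> carrier};
  twist : {linear carrier -> carrier}
}.

Arguments mu {k} h.
Arguments twist {k} h.

Definition multiplicative (k : comNzRingType) (A : homAlgebra k) : Prop :=
  forall x y : A, twist A (mu A x y) = mu A (twist A x) (twist A y).

Definition homAssociator (k : comNzRingType) (A : homAlgebra k) (x y z : A) : A :=
  mu A (mu A x y) (twist A z) - mu A (twist A x) (mu A y z).

Definition rightHomAlternative (k : comNzRingType) (A : homAlgebra k) : Prop :=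
  forall x y : A, homAssociator x y y = 0.

(* Only n >= 1 is meaningful, as A need not be unital; the value at n = 0 is
   a dummy. *)
Fixpoint homPower (k : comNzRingType) (A : homAlgebra k) (x : A) (n : nat) : A :=
  match n with
  | 0 => 0
  | 1 => x
  | (m.+1 as n').+1 => mu A (homPower x n') (iter m (twist A) x)
  end.

(* Main.v *)
(* The untwisted identity is due to Mikheev. In a right alternative algebra with
   2 invertible, a sum of a word in right multiplications and its reversal is, for
   words in three generators, again a right multiplication R_t; and R_t = 0 as soon
   as its formal value t at 1 vanishes. Put p = ab, D = R_a R_b - R_p (operators
   act on the right), D* = R_b R_a - R_p and c = (a,a,b) = aD. This principle gives
   D D* = 0, then D R_c = - R_c D*, then R_c^2 = R_a D R_c - D R_c R_a, and, as
   D* D and D* R_a D are right multiplications too,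
   D R_c D R_c = 0 = D R_c R_a D R_c. Since 1 D = 0, the value of R_c^4 at 1, which
   is c^4, vanishes.

   The Hom-version reduces to this one through a graded algebra whose product
   absorbs the twisting map; there c^4 appears as alpha^6 of the Hom-power. *)

From mathcomp Require Import all_boot all_order all_algebra.
Import GRing.Theory.
Require Import Defs.

Set Implicit Arguments.
Unset Strict Implicit.
Unset Printing Implicit Defensive.

Local Open Scope ring_scope.

(** * Cancellation in abelian groups *)

Lemma eq_of_sub0 (V : zmodType) (x y : V) : x - y + 0 = 0 -> x = y.
Proof. by rewrite addr0 => /eqP; rewrite subr_eq0 => /eqP. Qed.

(** Subtracts a known identity from the goal; chained uses reduce the goal to a formal cancellation
    for [zmod_cancel]. *)
Lemma eq_of_add_eq (V : zmodType) (u w x y : V) :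
  u = w -> x + w = y + u -> x = y.
Proof. by move=> -> /addIr. Qed.

Ltac zmod_cancel :=
  apply: eq_of_sub0; rewrite ?(opprD, opprK, oppr0) -?addrA ?add0r;
  repeat match goal with
  | |- - ?x + _ = 0 => rewrite ?(addrCA _ x) addNKr
  | |- ?x + _ = 0 => rewrite ?(addrCA _ (- x)) addKr
  end; try reflexivity.

(** * Mikheev's identity in right alternative rings without 2-torsion *)

Section RightAlternative.
Variables (V : zmodType) (mul : V -> V -> V).
Local Infix "∙" := mul (at level 40, left associativity).
Hypothesis mulDl : forall x y z, (x + y) ∙ z = x ∙ z + y ∙ z.
Hypothesis mulDr : forall x y z, x ∙ (y + z) = x ∙ y + x ∙ z.
Hypothesis mul_alt : forall x y, x ∙ y ∙ y = x ∙ (y ∙ y).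
Hypothesis V_torsion2 : forall x : V, x + x = 0 -> x = 0.

Let mul0l x : 0 ∙ x = 0.
Proof. by apply: (addrI (0 ∙ x)); rewrite -mulDl !addr0. Qed.
Let mul0r x : x ∙ 0 = 0.
Proof. by apply: (addrI (x ∙ 0)); rewrite -mulDr !addr0. Qed.
Let mulNl x y : (- x) ∙ y = - (x ∙ y).
Proof. by apply/eqP; rewrite -addr_eq0 -mulDl addNr mul0l. Qed.
Let mulNr x y : x ∙ (- y) = - (x ∙ y).
Proof. by apply/eqP; rewrite -addr_eq0 -mulDr addNr mul0r. Qed.
Let mulBl x y z : (x - y) ∙ z = x ∙ z - y ∙ z.
Proof. by rewrite mulDl mulNl. Qed.

Lemma mul_alt_lin v x y : v ∙ x ∙ y + v ∙ y ∙ x = v ∙ (x ∙ y + y ∙ x).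
Proof.
apply: (eq_of_add_eq (mul_alt v (x + y))).
rewrite !(mulDl, mulDr) !mul_alt; zmod_cancel.
Qed.

(** For the Jordan product [x o y = xy + yx], which right multiplication preserves by [mul_alt_lin],
    one has [2 xyx = (x o y) o x - (xx) o y]. *)
Lemma right_moufang v x y : v ∙ x ∙ y ∙ x = v ∙ (x ∙ y ∙ x).
Proof.
have double_inj (u w : V) : u + u = w + w -> u = w.
  move=> e; apply/eqP; rewrite -subr_eq0; apply/eqP/V_torsion2.
  by rewrite addrACA -opprD e subrr.
have e1 := mul_alt_lin v (x ∙ y + y ∙ x) x.
have e2 := mul_alt_lin v (x ∙ x) y.
rewrite -(mul_alt_lin v x y) -(mul_alt_lin (v ∙ x) x y) in e1.
rewrite -(mul_alt_lin x x y) in e1.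
apply: double_inj; apply: (eq_of_add_eq e1); apply: (eq_of_add_eq (esym e2)).
rewrite !(mulDl, mulDr) !mul_alt; zmod_cancel.
Qed.

Lemma right_moufang_lin v x y z :
  v ∙ x ∙ y ∙ z + v ∙ z ∙ y ∙ x = v ∙ (x ∙ y ∙ z + z ∙ y ∙ x).
Proof.
apply: (eq_of_add_eq (right_moufang v (x + z) y)).
rewrite !(mulDl, mulDr) !right_moufang; zmod_cancel.
Qed.

Variables a b : V.
Let p := a ∙ b.
Let D v := v ∙ a ∙ b - v ∙ p.
(* The image of [D = R_a R_b - R_p] under reversal of operator words. *)
Let D' v := v ∙ b ∙ a - v ∙ p.
Let c := D a.

Let D0 : D 0 = 0.
Proof. by rewrite /D !mul0l subrr. Qed.
Let DN v : D (- v) = - D v.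
Proof. by rewrite /D !mulNl opprD. Qed.

(** The expansion is symmetric under reversal, so it is right multiplication by its formal value at
    1, which is [pba - (pp + pba) + pp = 0]. *)
Let D'D v : D' (D v) = 0.
Proof.
apply: (eq_of_add_eq (esym (right_moufang_lin v a b p))).
rewrite /D' /D !(mulDl, mulDr, mulNl) !mul_alt.
by rewrite right_moufang -(mul_alt a b) -/p; zmod_cancel.
Qed.

(** The difference of the two sides is right multiplication by [(pc + cba) - (pc + cp) = D' c],
    which vanishes by [D'D]. *)
Let Dc v : D v ∙ c = - D' (v ∙ c).
Proof.
have e : c ∙ b ∙ a = c ∙ p by apply/eqP; rewrite -subr_eq0; apply/eqP/D'D.
clearbody c.
apply: (eq_of_add_eq (right_moufang_lin v a b c)).
apply: (eq_of_add_eq (esym (mul_alt_lin v p c))).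
by rewrite e -/p !(mulDr) /D' /D mulBl; zmod_cancel.
Qed.

(** By [Dc] the right side is [D (va) c + D' (vc) a], that is, right multiplication by
    [(D a) c + (D' c) a = cc]. *)
Let mulcc v : v ∙ c ∙ c = D (v ∙ a) ∙ c - D v ∙ c ∙ a.
Proof.
have D'c : (c ∙ b ∙ a - c ∙ p) ∙ a = 0 by rewrite -/(D' c) D'D mul0l.
have cE : c = a ∙ a ∙ b - a ∙ p by [].
clearbody c; rewrite (Dc v) mulNl opprK mul_alt {1}cE /D.
apply: (eq_of_add_eq (esym (right_moufang_lin v (a ∙ a) b c))).
apply: (eq_of_add_eq (right_moufang_lin v a p c)).
apply: (eq_of_add_eq (esym (congr1 (mul v) D'c))).
rewrite /D' !(mulDl, mulDr, mulNl, mulNr) mul0r !mul_alt; zmod_cancel.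
Qed.

(* [v |-> D (X (D' v))] is symmetric, hence is right multiplication by some [s];
   as [D' c = 0], evaluating at [c] gives [c s = 0], whence [c (s c) = 0]. *)
Let sandwich (X : V -> V) (z t r v : V) :
  (forall u w, X (u - w) = X u - X w) ->
  (forall u, X (u ∙ a) = u ∙ z) -> (forall u, X u ∙ a = u ∙ z) ->
  (forall u, u ∙ z ∙ a = u ∙ t) -> (forall u, X (u ∙ p) ∙ p = u ∙ r) ->
  D (X (D v ∙ c)) ∙ c = 0.
Proof.
move=> XB Xa Xa' za Xp.
have [s Ds] : exists s, forall u, D (X (D' u)) = u ∙ s.
  (* The four terms of [(R_b R_a - R_p) X (R_a R_b - R_p)], with [R_a X = X R_a = R_z],
     [R_z R_a = R_t] and [R_p X R_p = R_r]. *)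
  exists (b ∙ t ∙ b - (b ∙ z ∙ p + p ∙ z ∙ b) + r) => u.
  rewrite /D /D' XB Xa !mulBl za Xp Xa' right_moufang.
  apply: (eq_of_add_eq (esym (right_moufang_lin u b z p))).
  rewrite !(mulDr, mulNr); zmod_cancel.
have X0 : X 0 = 0 by have := XB 0 0; rewrite !subrr.
have XN u : X (- u) = - X u by rewrite -sub0r XB X0 sub0r.
rewrite (Dc v) XN DN mulNl Ds right_moufang -Ds.
by rewrite D'D X0 D0 mul0l mul0r oppr0.
Qed.

Lemma mikheev d : d = a ∙ a ∙ b - a ∙ (a ∙ b) -> d ∙ d ∙ d ∙ d = 0.
Proof.
move=> ->; rewrite -/p -/(D a) -/c.
(* Reading the innermost left [c] as [D a] gives two instances of [sandwich] at [v = a]: [X = R_a],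
   then [X = id]. *)
rewrite mulcc {1 4}/c.
rewrite (@sandwich (mul^~ a) (a ∙ a) (a ∙ a ∙ a) (p ∙ a ∙ p)) //; first last.
- by move=> u; rewrite right_moufang.
- by move=> u; rewrite -mul_alt right_moufang.
by rewrite (@sandwich id a (a ∙ a) (p ∙ p)) // mul0l subrr.
Qed.
End RightAlternative.

(** * Reduction of Hom-algebras to ordinary algebras *)

(* The component of index [d] has degree [d.+1]; the graded product
   [x_d y_e = (alpha^e x alpha^d y)_(d+e+1)] turns Hom-associators into associators,
   even if [twist A] is not bijective. Degrees are truncated at 12, that of
   [(a, a, b)^4]. *)
Section Untwisting.
Variables (k : comNzRingType) (A : homAlgebra k).
Hypothesis A_mult : multiplicative A.
Hypothesis A_alt : rightHomAlternative A.
Hypothesis A_torsion2 : forall x : A, x + x = 0 -> x = 0.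

Let tau n (x : A) : A := iter n (twist A) x.

Let tauD n : {morph tau n : x y / x + y}.
Proof. by elim: n => //= n IH x y; rewrite -raddfD -IH. Qed.
Let tau0 n : tau n 0 = 0.
Proof. by elim: n => //= n ->; rewrite raddf0. Qed.
Let tau_sum n I (r : seq I) (F : I -> A) :
  tau n (\sum_(i <- r) F i) = \sum_(i <- r) tau n (F i).
Proof. exact: (big_morph _ (tauD n) (tau0 n)). Qed.
Let tauMn n m (x : A) : tau n (x *+ m) = tau n x *+ m.
Proof. by elim: m => [|m IH]; rewrite ?tau0 // !mulrS tauD IH. Qed.
Let tau_mu n (x y : A) : tau n (mu A x y) = mu A (tau n x) (tau n y).
Proof. by elim: n => //= n ->; rewrite A_mult. Qed.
Let tau_tau m n (x : A) : tau m (tau n x) = tau (m + n) x.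
Proof. by rewrite /tau iterD. Qed.

Let mu0l (y : A) : mu A 0 y = 0. Proof. exact: linear0l. Qed.
Let mu0r (x : A) : mu A x 0 = 0. Proof. exact: linear0r. Qed.
Let muDl (x y z : A) : mu A (x + y) z = mu A x z + mu A y z.
Proof. exact: linearDl. Qed.
Let muDr (x y z : A) : mu A x (y + z) = mu A x y + mu A x z.
Proof. exact: linearDr. Qed.
Let mu_suml I (r : seq I) (F : I -> A) y :
  mu A (\sum_(i <- r) F i) y = \sum_(i <- r) mu A (F i) y.
Proof. exact: (big_morph _ (fun u v => muDl u v y) (mu0l y)). Qed.
Let mu_sumr I (r : seq I) (F : I -> A) x :
  mu A x (\sum_(i <- r) F i) = \sum_(i <- r) mu A x (F i).
Proof. exact: (big_morph _ (muDr x) (mu0r x)). Qed.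
Let muMnl m (x y : A) : mu A (x *+ m) y = mu A x y *+ m.
Proof. by elim: m => [|m IH]; rewrite ?mu0l // !mulrS muDl IH. Qed.
Let muMnr m (x y : A) : mu A x (y *+ m) = mu A x y *+ m.
Proof. by elim: m => [|m IH]; rewrite ?mu0r // !mulrS muDr IH. Qed.

Let G := {ffun 'I_12 -> A}.

Definition gmul (u v : {ffun 'I_12 -> A}) : {ffun 'I_12 -> A} :=
  [ffun n : 'I_12 => \sum_(i < 12) \sum_(j < 12)
     mu A (tau j (u i)) (tau i (v j)) *+ (j + i.+1 == n)%N].

Definition homogeneous (d : nat) (x : A) : {ffun 'I_12 -> A} :=
  [ffun n : 'I_12 => x *+ (d == n :> nat)].

(** Eliminates the intermediate index of a triple product. Truncation loses nothing: if [s >= 12],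
    then [s + l] exceeds [n] too. *)
Let sum_delta (s l : nat) (n : 'I_12) (F : nat -> A) :
  \sum_(m < 12) F m *+ (s == m :> nat) *+ (m + l == n)%N = F s *+ (s + l == n)%N.
Proof.
have [s12|s12] := ltnP s 12.
  rewrite (bigD1 (Ordinal s12)) //= eqxx big1 ?addr0 // => m.
  by rewrite -val_eqE /= eq_sym => /negPf->; rewrite mul0rn.
rewrite big1 => [|m _].
  by rewrite gtn_eqF // (leq_trans (ltn_ord n)) // (leq_trans s12) ?leq_addr.
by rewrite gtn_eqF ?mul0rn // (leq_trans (ltn_ord m)).
Qed.

Let gmulDl u v w : gmul (u + v) w = gmul u w + gmul v w.
Proof.
apply/ffunP => n; rewrite !ffunE -big_split; apply: eq_bigr => i _.
rewrite -big_split; apply: eq_bigr => j _.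
by rewrite ffunE tauD muDl mulrnDl.
Qed.

Let gmulDr u v w : gmul u (v + w) = gmul u v + gmul u w.
Proof.
apply/ffunP => n; rewrite !ffunE -big_split; apply: eq_bigr => i _.
rewrite -big_split; apply: eq_bigr => j _.
by rewrite ffunE tauD muDr mulrnDl.
Qed.

Let gmul_homogeneous d e x y :
  gmul (homogeneous d x) (homogeneous e y) =
  homogeneous (e + d.+1) (mu A (tau e x) (tau d y)).
Proof.
apply/ffunP => n; rewrite !ffunE (addnC e) addSnnS.
have <- := sum_delta d e.+1 n (fun i => mu A (tau e x) (tau i y)).
apply: eq_bigr => i _; rewrite -addSnnS (addnC i.+1).
have <- := sum_delta e i.+1 n (fun j => mu A (tau j x) (tau i y) *+ (d == i :> nat)).
apply: eq_bigr => j _; rewrite !ffunE !tauMn muMnl muMnr; congr (_ *+ _).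
by rewrite mulrnAC.
Qed.

(** Here and in [gmul_mulr] the [+1] in the index of a product supplies the outer [twist A], so the
    two expansions differ termwise by Hom-associators. *)
Let gmul_mull u v w n : gmul (gmul u v) w n =
  \sum_(i < 12) \sum_(j < 12) \sum_(l < 12)
    mu A (mu A (tau (j + l) (u i)) (tau (i + l) (v j)))
         (twist A (tau (i + j) (w l))) *+ (i + j + l.+2 == n)%N.
Proof.
pose T (m l i j : 'I_12) :=
  mu A (mu A (tau (j + l) (u i)) (tau (i + l) (v j))) (tau m (w l))
    *+ (j + i.+1 == m)%N *+ (m + l.+1 == n)%N.
transitivity (\sum_(m < 12) \sum_(l < 12) \sum_(i < 12) \sum_(j < 12) T m l i j).
  rewrite ffunE; apply: eq_bigr => m _; apply: eq_bigr => l _.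
  rewrite ffunE tau_sum mu_suml -sumrMnl; apply: eq_bigr => i _.
  rewrite tau_sum mu_suml -sumrMnl; apply: eq_bigr => j _.
  rewrite tauMn muMnl tau_mu !tau_tau /T (addnC l j) (addnC l i).
  by rewrite (addnC l m.+1) addSnnS.
under eq_bigr => m _ do rewrite exchange_big.
rewrite exchange_big; apply: eq_bigr => i _.
under eq_bigr => m _ do rewrite exchange_big.
rewrite exchange_big; apply: eq_bigr => j _.
rewrite exchange_big; apply: eq_bigr => l _.
rewrite /T (sum_delta _ _ _ (fun m => mu A _ (tau m (w l)))).
by rewrite addnS addSnnS (addnC j i).
Qed.

Let gmul_mulr u v w n : gmul u (gmul v w) n =
  \sum_(i < 12) \sum_(j < 12) \sum_(l < 12)
    mu A (twist A (tau (j + l) (u i)))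
         (mu A (tau (i + l) (v j)) (tau (i + j) (w l))) *+ (i + j + l.+2 == n)%N.
Proof.
rewrite ffunE; apply: eq_bigr => i _.
pose T (m j l : 'I_12) :=
  mu A (tau m (u i)) (mu A (tau (i + l) (v j)) (tau (i + j) (w l)))
    *+ (l + j.+1 == m)%N *+ (m + i.+1 == n)%N.
transitivity (\sum_(m < 12) \sum_(j < 12) \sum_(l < 12) T m j l).
  apply: eq_bigr => m _.
  rewrite ffunE tau_sum mu_sumr -sumrMnl; apply: eq_bigr => j _.
  rewrite tau_sum mu_sumr -sumrMnl; apply: eq_bigr => l _.
  by rewrite tauMn muMnr tau_mu !tau_tau.
rewrite exchange_big; apply: eq_bigr => j _.
rewrite exchange_big; apply: eq_bigr => l _.
rewrite /T (sum_delta _ _ _ (fun m => mu A (tau m (u i)) _)).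
rewrite addnS (addnC j); congr (_ *+ (_ == _)).
by rewrite addnS addnC !addnS addnA (addnAC i).
Qed.

Let alt_swap (x y z : A) : homAssociator x y z = - homAssociator x z y.
Proof.
apply/eqP; rewrite -addr_eq0; apply/eqP.
apply: (eq_of_add_eq (A_alt x (y + z))); apply: (eq_of_add_eq (esym (A_alt x y))).
apply: (eq_of_add_eq (esym (A_alt x z))).
rewrite /homAssociator !(raddfD (twist A)) !(muDl, muDr); zmod_cancel.
Qed.

Let gmul_alt u v : gmul (gmul u v) v = gmul u (gmul v v).
Proof.
apply/ffunP => n; apply/eqP; rewrite -subr_eq0 gmul_mull gmul_mulr -sumrB.
apply/eqP; apply: big1 => i _.
rewrite -sumrB; under eq_bigr => j _.
  rewrite -sumrB; under eq_bigr => l _ do rewrite -mulrnBl -/(homAssociator _ _ _).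
  over.
set S := (X in X = 0).
(* Doubling [S] pairs the term [(j, l)] with [(l, j)]; the two cancel by [alt_swap], the diagonal
   included. *)
apply: A_torsion2; rewrite {1}/S exchange_big -big_split big1 // => j _.
rewrite -big_split big1 // => l _ /=.
have -> : (i + l + j.+2 = i + j + l.+2)%N by rewrite !addnS (addnAC i).
by rewrite alt_swap mulNrn (addnC l j) addNr.
Qed.

Lemma untwisted_mikheev a b :
  iter 6 (twist A) (homPower (homAssociator a a b) 4) = 0.
Proof.
have G_torsion2 (x : G) : x + x = 0 -> x = 0.
  move=> xx0; apply/ffunP => n; rewrite ffunE; apply: A_torsion2.
  by have := congr1 (fun f : G => f n) xx0; rewrite !ffunE.
have homB d x y : homogeneous d x - homogeneous d y = homogeneous d (x - y).
  by apply/ffunP => n; rewrite !ffunE mulrnBl.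
have := @mikheev G gmul gmulDl gmulDr gmul_alt G_torsion2 (homogeneous 0 a)
  (homogeneous 0 b) (homogeneous 2 (homAssociator a a b)).
(* The powers of [c = (a, a, b)] have indices 2, 5, 8, 11; the last one is [((alpha^6 c alpha^6 c)
   alpha^7 c) alpha^8 c], in the top component. *)
rewrite !gmul_homogeneous homB => /(_ erefl) /(congr1 (fun f : G => f ord_max)).
by rewrite !ffunE mulr1n /= !A_mult.
Qed.
End Untwisting.

Theorem corollary1p2 (k : fieldType) (hchar : [pchar k] =i pred0)
    (A : homAlgebra k) (hmult : multiplicative A)
    (halt : rightHomAlternative A) (hinj : injective (twist A)) (a b : A) :
  homPower (homAssociator a a b) 4 = 0.
Proof.
have torsion2 (x : A) : x + x = 0 -> x = 0.
  move=> /eqP; rewrite -mulr2n -scaler_nat scaler_eq0 => /orP[|/eqP //].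
  by have := hchar 2; rewrite !inE /= => ->.
do 6 apply/hinj; rewrite !raddf0.
exact: (untwisted_mikheev hmult halt torsion2).
Qed.
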